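(* For every Brouwer code $b:\mathrm{B}$, (1) the ordinal $[\![b]\!]_{\Sigma}$ is trichotomous; (2) the underlying type of $[\![b]\!]_{\Sigma^1}$ is compact and totally separated; (3) the underlying type of $[\![b]\!]_{\Sigma^1}$ is a retract of $\mathbf{2}^{\mathbb{N}}$; (4) the underlying type of $[\![b]\!]_{\sup^1}$ is compact.
   Context: Foundation: intensional Martin-Löf type theory as in the HoTT Book, with $\mathbf 0$, $\mathbf 1$ (point $\star$), $\mathbf 2$ (points $0,1$), $\mathbb N$, $+$, $\Pi$, $\Sigma$, $\mathsf W$-types, universes, univalence (hence function and propositional extensionality), propositional truncation and set quotients (equivalently set replacement: the image of a map from a small type into a locally small set is small). No excluded middle is assumed. $\Sigma$ and $+$ are untruncated. A proposition is a type with at most one element; $f^{-1}(y):=\Sigma_{x}(f\,x=y)$; an embedding is a map all of whose fibers are propositions. $X$ is decidable if $X+\neg X$. A type $X$ is compact if for every $p:X\to\mathbf 2$ the type $\Sigma_{x:X}\,p\,x=0$ is decidable. $X$ is totally separated if for all $x,y:X$, $(\prod_{p:X\to\mathbf 2}p\,x=p\,y)\to x=y$. $Y$ is a retract of $X$ if there are $r:X\to Y$, $s:Y\to X$ with $r\circ s$ the identity. Ordinals. An ordinal is a type with a proposition-valued, transitive, extensional (elements with the same predecessors are equal), well-founded (every element accessible) relation $<$. $\mathrm{Ord}$ is the type of ordinals with underlying type in a fixed base universe; the same symbol denotes an ordinal and its underlying type. $\mathbf 0,\mathbf 1$ are ordinals with the empty order; $\omega$ is $\mathbb N$ with its usual order.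 An ordinal is trichotomous if for all $x,y$ we have $x<y$ or $x=y$ or $y<x$; $\mathrm{Ord}_3$ is the type of trichotomous ordinals. The sum $\alpha+\beta$ of ordinals has underlying type the binary sum, with every $\mathrm{inl}\,x$ below every $\mathrm{inr}\,y$ and the given orders within each summand. A topped ordinal is an ordinal with a specified point $t$ such that $\neg(t<y)$ for all $y$; $\mathrm{Ord}^\top$ is their type. For an ordinal $\tau$ and a family $\upsilon:\tau\to\mathrm{Ord}$, $\Sigma_\tau\upsilon$ is $\Sigma_{x:\tau}\upsilon\,x$ with the lexicographic order: $(x,a)<(x',a')$ iff $x<x'$, or there is $r:x=x'$ such that the transport of $a$ along $r$ is below $a'$. This is an ordinal if $\tau$ is trichotomous (and it is trichotomous if moreover every $\upsilon\,x$ is), or if every $\upsilon\,x$ is topped; if $\tau$ and all $\upsilon\,x$ are topped, its top is the pair of the top of $\tau$ with the top of the fiber over it. The sum $\tau+\upsilon$ of topped ordinals is the lexicographic sum, over the two-point topped ordinal with underlying type $\mathbf 1+\mathbf 1$ and $\mathrm{inl}\,\star<\mathrm{inr}\,\star$, of the family with members $\tau,\upsilon$. Order on $\mathrm{Ord}$: $\alpha\le\beta$ means there is a simulation $\alpha\to\beta$, i.e. an order-preserving map $f$ such that every $z<f\,x$ is $f\,x'$ for some $x'<x$. For $\alpha:I\to\mathrm{Ord}$ with $I$ small, $\sup\alpha$ is the least upper bound of $\alpha$ with respect to $\le$; it is constructed as the image of $\Sigma_{i:I}\alpha\,i\to\mathrm{Ord}$, $(i,x)\mapsto$ the initial segment of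 $\alpha\,i$ at $x$, ordered as a subtype of $\mathrm{Ord}$ (where $\alpha$ is below $\beta$ iff $\alpha$ is a proper initial segment of $\beta$), and made small by set replacement. Conaturals: $\mathbb N_\infty:=\Sigma_{u:\mathbf 2^{\mathbb N}}\prod_i u_{i+1}\le u_i$; $\underline n$ is $n$ ones followed by zeros; $\infty$ is constantly $1$; $\iota:\mathbb N\hookrightarrow\mathbb N_\infty$, $\iota\,n=\underline n$. It is a topped ordinal with top $\infty$ under $u<v:\equiv\Sigma_{n:\mathbb N}(u=\underline n)\times(v_n=1)$. Extension: for an embedding $j:X\hookrightarrow K$ and $\alpha:X\to\mathrm{Ord}$, the family $\alpha/j:K\to\mathrm{Ord}$ has $(\alpha/j)\,k:=\prod_{(x,p):j^{-1}(k)}\alpha\,x$ with order $u<v:\equiv\Sigma_{p:j^{-1}(k)}\,u\,p<v\,p$; if all $\alpha\,x$ are topped then so is $(\alpha/j)\,k$, by the function assigning tops. Brouwer codes: $\mathrm B$ is the inductive type with constructors $\mathsf Z:\mathrm B$, $\mathsf S:\mathrm B\to\mathrm B$, $\mathsf L:(\mathbb N\to\mathrm B)\to\mathrm B$. Interpretations, defined by induction: - $[\![-]\!]_{\Sigma}:\mathrm B\to\mathrm{Ord}_3$: $\mathsf Z\mapsto\mathbf 0$; $\mathsf S\,b\mapsto[\![b]\!]_\Sigma+\mathbf 1$; $\mathsf L\,b\mapsto\Sigma_{\omega}(n\mapsto[\![b\,n]\!]_\Sigma)$. - $[\![-]\!]_{\Sigma^1}:\mathrm B\to\mathrm{Ord}^\top$: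 $\mathsf Z\mapsto\mathbf 1$; $\mathsf S\,b\mapsto[\![b]\!]_{\Sigma^1}+\mathbf 1$; $\mathsf L\,b\mapsto\Sigma_{\mathbb N_\infty}\big((n\mapsto[\![b\,n]\!]_{\Sigma^1})/\iota\big)$. - $[\![-]\!]_{\sup^1}:\mathrm B\to\mathrm{Ord}$: $\mathsf Z\mapsto\mathbf 1$; $\mathsf S\,b\mapsto[\![b]\!]_{\sup^1}+\mathbf 1$; $\mathsf L\,b\mapsto\sup\big((n\mapsto[\![b\,n]\!]_{\sup^1})/\iota\big)$, a supremum indexed by $\mathbb N_\infty$. *)

(* Defs.v *)
(* The univalent foundation is rendered set-theoretically and without excluded
   middle: propositions are [Prop], and of univalence and truncation we keep
   function extensionality, propositional extensionality and the principle of
   unique choice ([constructive_definite_description]), which eliminates the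
   [Prop]-valued [exists] into types with at most one element.  Every type is
   then a set.  Data that is untruncated in type theory (decidability,
   trichotomy, retractions) lives in [Type]. *)
From Stdlib Require Import Arith Bool Lia.
From Stdlib Require Import FunctionalExtensionality PropExtensionality.
From Stdlib Require Import ClassicalFacts Description.

Set Implicit Arguments.
Unset Strict Implicit.
Unset Printing Implicit Defensive.

Lemma proof_irrel (P : Prop) (p q : P) : p = q.
Proof. exact (ext_prop_dep_proof_irrel_cic propositional_extensionality P p q). Qed.

Lemma sig_ext (A : Type) (P : A -> Prop) (u v : {x : A | P x}) :
  proj1_sig u = proj1_sig v -> u = v.
Proof.
  destruct u as [x p], v as [y q]; simpl; intros <-.
  now rewrite (proof_irrel p q).
Qed.

(** * Types *)

Definition is_prop (A : Type) : Prop := forall x y : A, x = y.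

Definition decidable (X : Type) : Type := (X + (X -> False))%type.

Definition fiber (X Y : Type) (f : X -> Y) (y : Y) : Type := {x : X | f x = y}.

Definition embedding (X Y : Type) (f : X -> Y) : Prop :=
  forall y, is_prop (fiber f y).

(* The points 0 and 1 of the two-point type are [false] and [true]. *)
Definition compact (X : Type) : Type :=
  forall p : X -> bool, decidable {x : X | p x = false}.

Definition totally_separated (X : Type) : Prop :=
  forall x y : X, (forall p : X -> bool, p x = p y) -> x = y.

Definition retract_of (Y X : Type) : Type :=
  {r : X -> Y & {s : Y -> X | forall y, r (s y) = y}}.

(** * Ordinals *)

(* The universe of [carrier] is monomorphic: it is the fixed base universe. *)
Record Ord := {
  carrier :> Type;
  lt : carrier -> carrier -> Prop;
  lt_trans : forall x y z, lt x y -> lt y z -> lt x z;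
  lt_ext : forall x y, (forall z, lt z x <-> lt z y) -> x = y;
  lt_wf : well_founded lt
}.

Definition trichotomous (a : Ord) : Type :=
  forall x y : a, ((lt x y + {x = y}) + lt y x)%type.

Record TOrd := {
  tord :> Ord;
  top : tord;
  top_max : forall y, ~ lt top y
}.

Lemma lt_irrefl (a : Ord) (x : a) : ~ lt x x.
Proof.
  induction (lt_wf x) as [x _ IH]. intros H. exact (IH x H H).
Qed.

Definition zero : Ord.
Proof.
  refine (@Build_Ord Empty_set (fun _ _ => False) _ _ _); intros [].
Defined.

Definition one : Ord.
Proof.
  refine (@Build_Ord unit (fun _ _ => False) _ _ _).
  - intros _ _ _ [].
  - now intros [] [] _.
  - intros x; constructor; intros _ [].
Defined.

Definition omega : Ord.
Proof.
  refine (@Build_Ord nat Peano.lt _ _ _).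
  - intros x y z; lia.
  - intros x y H. pose proof (H x) as [_ H1]. pose proof (H y) as [H2 _]. lia.
  - exact Wf_nat.lt_wf.
Defined.

Lemma omega_trichotomous : trichotomous omega.
Proof.
  intros x y. destruct (lt_eq_lt_dec x y) as [[H|H]|H].
  - left; left; exact H.
  - left; right; exact H.
  - right; exact H.
Qed.

(** ** Sums *)

Definition sum_lt (a b : Ord) (u v : a + b) : Prop :=
  match u, v with
  | inl x, inl y => lt x y
  | inl _, inr _ => True
  | inr _, inl _ => False
  | inr x, inr y => lt x y
  end.

Definition ord_sum (a b : Ord) : Ord.
Proof.
  refine (@Build_Ord (a + b) (@sum_lt a b) _ _ _).
  - intros [x|x] [y|y] [z|z]; simpl; try tauto; apply lt_trans.
  - intros [x|x] [y|y] H.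
    + f_equal; apply lt_ext; intros z; exact (H (inl z)).
    + exfalso; exact (lt_irrefl (proj2 (H (inl x)) I)).
    + exfalso; exact (lt_irrefl (proj1 (H (inl y)) I)).
    + f_equal; apply lt_ext; intros z; exact (H (inr z)).
  - assert (Hl : forall x, Acc (@sum_lt a b) (inl x)).
    { intros x; induction (lt_wf x) as [x _ IH].
      constructor; intros [y|y]; simpl; [apply IH | intros []]. }
    intros [x|x]; [apply Hl|].
    induction (lt_wf x) as [x _ IH].
    constructor; intros [y|y]; simpl; [intros _; apply Hl | apply IH].
Defined.

Section Lex.
Variables (t : Ord) (u : t -> Ord).

Definition lex_lt (p q : {x : t & u x}) : Prop :=
  lt (projT1 p) (projT1 q) \/
  exists r : projT1 p = projT1 q,
    lt (eq_rect (projT1 p) (fun x => carrier (u x)) (projT2 p) (projT1 q) r)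
       (projT2 q).

Lemma lex_lt_trans p q s : lex_lt p q -> lex_lt q s -> lex_lt p s.
Proof.
  destruct p as [x a], q as [y b], s as [z c]; unfold lex_lt; simpl.
  intros [H|[r H]] [K|[r' K]].
  - left; exact (lt_trans H K).
  - left; now destruct r'.
  - left; now destruct r.
  - right; destruct r, r'; exists eq_refl; exact (lt_trans H K).
Qed.

Lemma lex_lt_wf : well_founded lex_lt.
Proof.
  intros [x a]; revert a; induction (lt_wf x) as [x _ IHx].
  intros a; induction (lt_wf a) as [a _ IHa].
  constructor; intros [y b]; unfold lex_lt; simpl; intros [H|[r H]].
  - exact (IHx y H b).
  - destruct r; exact (IHa b H).
Qed.

Lemma lex_lt_fiber x (a b : u x) :
  lex_lt (existT _ x a) (existT _ x b) <-> lt a b.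
Proof.
  split.
  - intros [H|[r H]]; simpl in *; [now apply lt_irrefl in H|].
    rewrite (proof_irrel r eq_refl) in H; exact H.
  - intros H; right; now exists eq_refl.
Qed.

Lemma lex_lt_ext_fiber x (a b : u x) :
  (forall p, lex_lt p (existT _ x a) <-> lex_lt p (existT _ x b)) ->
  existT (fun x => carrier (u x)) x a = existT _ x b.
Proof.
  intros H; f_equal; apply lt_ext; intros z.
  rewrite <- 2!lex_lt_fiber; apply H.
Qed.

Lemma lex_lt_ext_trichotomous (tri : trichotomous t) p q :
  (forall z, lex_lt z p <-> lex_lt z q) -> p = q.
Proof.
  assert (lex_irr : forall p, ~ lex_lt p p).
  { intros p0; induction (lex_lt_wf p0) as [p0 _ IH]; intros H; exact (IH p0 H H). }
  destruct p as [x a], q as [y b]; intros H.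
  destruct (tri x y) as [[K|K]|K].
  - exfalso; apply (lex_irr (existT _ x a)), H; now left.
  - destruct K; now apply lex_lt_ext_fiber.
  - exfalso; apply (lex_irr (existT _ y b)), H; now left.
Qed.

Definition lex_sum (tri : trichotomous t) : Ord :=
  Build_Ord lex_lt_trans (lex_lt_ext_trichotomous tri) lex_lt_wf.
End Lex.

Section LexTopped.
Variables (t : TOrd) (u : t -> TOrd).

Lemma lex_lt_ext_topped p q :
  (forall z, lex_lt (u := fun x : t => tord (u x)) z p <-> lex_lt z q) -> p = q.
Proof.
  destruct p as [x a], q as [y b]; intros H.
  assert (K : x = y).
  { apply lt_ext; intros z.
    destruct (H (existT _ z (top (u z)))) as [H1 H2].
    split; intros L.
    - destruct (H1 (or_introl L)) as [M|[r M]]; [exact M|].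
      simpl in r; destruct r; now apply top_max in M.
    - destruct (H2 (or_introl L)) as [M|[r M]]; [exact M|].
      simpl in r; destruct r; now apply top_max in M. }
  destruct K; now apply lex_lt_ext_fiber.
Qed.

Definition lex_tsum : TOrd.
Proof.
  refine (@Build_TOrd
    (Build_Ord (@lex_lt_trans t u) lex_lt_ext_topped (@lex_lt_wf t u))
    (existT _ (top t) (top (u (top t)))) _).
  intros [y b] [H|[r H]]; simpl in *; [now apply top_max in H|].
  destruct r; now apply top_max in H.
Defined.
End LexTopped.

Definition tone : TOrd.
Proof. refine (@Build_TOrd one tt _); intros _ []. Defined.

Definition ttwo : TOrd.
Proof. refine (@Build_TOrd (ord_sum one one) (inr tt) _); intros [|] []. Defined.

Definition tord_sum (a b : TOrd) : TOrd :=
  @lex_tsum ttwo (fun i => match i with inl _ => a | inr _ => b end).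

(** ** Extension of a family along an embedding *)

Section Extension.
Variables (X K : Type) (j : X -> K) (emb : embedding j).

Section Plain.
Variables (a : X -> Ord) (k : K).

Definition ext_carrier : Type := forall p : fiber j k, a (proj1_sig p).

Definition ext_lt (u v : ext_carrier) : Prop :=
  exists p : fiber j k, lt (u p) (v p).

Definition ext_ord : Ord.
Proof.
  refine (@Build_Ord ext_carrier ext_lt _ _ _).
  - intros u v w [p H] [q L]; exists p.
    rewrite (emb q p) in L; exact (lt_trans H L).
  - intros u v H; apply functional_extensionality_dep; intros p.
    apply lt_ext.
    assert (E : forall z : a (proj1_sig p), exists w : ext_carrier, w p = z).
    { intros z.
      exists (fun q => eq_rect p (fun q => carrier (a (proj1_sig q))) z q (emb p q)).
      now rewrite (proof_irrel (emb p p) eq_refl). }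
    intros z; destruct (E z) as [w <-].
    destruct (H w) as [H1 H2]; split; intros L.
    + destruct (H1 (ex_intro _ p L)) as [q M]; now rewrite (emb q p) in M.
    + destruct (H2 (ex_intro _ p L)) as [q M]; now rewrite (emb q p) in M.
  - intros u; constructor; intros v [p _].
    enough (E : forall (z : a (proj1_sig p)) (v : ext_carrier),
              v p = z -> Acc ext_lt v) by now apply (E (v p)).
    clear u v; intros z; induction (lt_wf z) as [z _ IH]; intros v <-.
    constructor; intros w [q H]; rewrite (emb q p) in H; now apply (IH (w p)).
Defined.
End Plain.

Definition ext_tord (a : X -> TOrd) (k : K) : TOrd.
Proof.
  refine (@Build_TOrd (ext_ord a k) (fun p => top (a (proj1_sig p))) _).
  intros v [p H]; now apply top_max in H.
Defined.
End Extension.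

(** ** Suprema *)

Definition segment (a : Ord) (x : a) : Ord.
Proof.
  refine (@Build_Ord {y : a | lt y x}
            (fun y z => lt (proj1_sig y) (proj1_sig z)) _ _ _).
  - intros y z w; apply lt_trans.
  - intros [y Hy] [z Hz] H; apply sig_ext, lt_ext; simpl in *; intros w.
    split; intros L.
    + exact (proj1 (H (exist _ w (lt_trans L Hy))) L).
    + exact (proj2 (H (exist _ w (lt_trans L Hz))) L).
  - intros [y Hy]; induction (lt_wf y) as [y _ IH].
    constructor; intros [z Hz] L; exact (IH z L Hz).
Defined.

(* By univalence this is the identity type of the type of ordinals, and it is
   used in its place. *)
Definition ord_iso (a b : Ord) : Prop :=
  exists (f : a -> b) (g : b -> a),
    (forall x, g (f x) = x) /\ (forall y, f (g y) = y) /\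
    (forall x y, lt x y <-> lt (f x) (f y)).

Definition ord_below (a b : Ord) : Prop := exists y : b, ord_iso a (segment y).

Lemma ord_iso_refl a : ord_iso a a.
Proof. now exists (fun x => x), (fun x => x). Qed.

Lemma ord_iso_sym a b : ord_iso a b -> ord_iso b a.
Proof.
  intros (f & g & gf & fg & H); exists g, f; repeat split; auto; intros L.
  - apply H; now rewrite 2!fg.
  - apply H in L; now rewrite 2!fg in L.
Qed.

Lemma ord_iso_trans a b c : ord_iso a b -> ord_iso b c -> ord_iso a c.
Proof.
  intros (f & g & gf & fg & H) (f' & g' & gf' & fg' & H').
  exists (fun x => f' (f x)), (fun z => g (g' z)); split; [|split].
  - intros x; now rewrite gf', gf.
  - intros z; now rewrite fg, fg'.
  - intros x y; now rewrite H, H'.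
Qed.

Lemma ord_iso_segment_segment (a : Ord) (x : a) (y : segment x) :
  ord_iso (segment y) (segment (proj1_sig y)).
Proof.
  destruct y as [y Hy]; simpl.
  exists (fun z : segment (a := segment x) (exist _ y Hy) =>
            exist (fun w => lt w y) (proj1_sig (proj1_sig z)) (proj2_sig z)).
  exists (fun z : segment y =>
            exist (fun w : segment x => lt w (exist _ y Hy))
              (exist _ (proj1_sig z) (lt_trans (proj2_sig z) Hy)) (proj2_sig z)).
  split; [|split].
  - intros z; apply sig_ext, sig_ext; reflexivity.
  - intros z; apply sig_ext; reflexivity.
  - intros z w; reflexivity.
Qed.

Lemma ord_iso_restrict (a b : Ord) (f : a -> b) (g : b -> a) :
  (forall x, g (f x) = x) -> (forall y, f (g y) = y) ->
  (forall x y, lt x y <-> lt (f x) (f y)) ->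
  forall x, ord_iso (segment x) (segment (f x)).
Proof.
  intros gf fg H x.
  assert (H' : forall z, lt z (f x) -> lt (g z) x).
  { intros z L; apply H; now rewrite fg. }
  exists (fun z : segment x =>
            exist (fun w => lt w (f x)) (f (proj1_sig z)) (proj1 (H _ _) (proj2_sig z))).
  exists (fun z : segment (f x) =>
            exist (fun w => lt w x) (g (proj1_sig z)) (H' _ (proj2_sig z))).
  split; [|split].
  - intros z; apply sig_ext, gf.
  - intros z; apply sig_ext, fg.
  - intros z w; apply H.
Qed.

Lemma ord_iso_segment_inj (a : Ord) (x y : a) :
  ord_iso (segment x) (segment y) -> x = y.
Proof.
  intros (f & g & gf & fg & H).
  assert (F : forall z : segment x, proj1_sig (f z) = proj1_sig z).
  { intros z; induction (lt_wf z) as [z _ IH]; apply lt_ext; intros w; split; intros L.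
    - pose (w' := exist _ w (lt_trans L (proj2_sig (f z))) : segment y).
      assert (M : lt (g w') z) by (apply H; rewrite fg; exact L).
      pose proof (IH _ M) as E; rewrite fg in E; simpl in E.
      rewrite E; exact M.
    - pose (w' := exist _ w (lt_trans L (proj2_sig z)) : segment x).
      assert (M : lt w' z) by exact L.
      pose proof (IH _ M) as E; simpl in E; rewrite <- E; now apply H. }
  apply lt_ext; intros z; split; intros L.
  - pose (z' := exist _ z L : segment x).
    pose proof (F z') as E; simpl in E; rewrite <- E; exact (proj2_sig (f z')).
  - pose (z' := exist _ z L : segment y).
    pose proof (F (g z')) as E; rewrite fg in E; simpl in E.
    rewrite E; exact (proj2_sig (g z')).
Qed.

Lemma segment_below (a : Ord) (x y : a) :
  lt x y <-> ord_below (segment x) (segment y).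
Proof.
  split.
  - intros L; exists (exist _ x L : segment y).
    exact (ord_iso_sym (ord_iso_segment_segment (exist _ x L : segment y))).
  - intros [z Hz].
    rewrite (ord_iso_segment_inj (ord_iso_trans Hz (ord_iso_segment_segment z))).
    exact (proj2_sig z).
Qed.

Lemma ord_below_iso a a' b b' :
  ord_iso a a' -> ord_iso b b' -> ord_below a b -> ord_below a' b'.
Proof.
  intros Ha (f & g & gf & fg & H) [y Hy]; exists (f y).
  apply ord_iso_trans with a; [now apply ord_iso_sym|].
  apply ord_iso_trans with (segment y); [exact Hy|].
  exact (ord_iso_restrict gf fg H y).
Qed.

Lemma ord_below_trans a b c : ord_below a b -> ord_below b c -> ord_below a c.
Proof.
  intros Hab [z Hz].
  destruct (ord_below_iso (ord_iso_refl a) Hz Hab) as [y Hy].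
  exists (proj1_sig y); exact (ord_iso_trans Hy (ord_iso_segment_segment y)).
Qed.

Lemma ord_below_ext (a b : Ord) :
  (forall x : a, ord_below (segment x) b) ->
  (forall y : b, ord_below (segment y) a) -> ord_iso a b.
Proof.
  intros Ha Hb.
  assert (C : forall a b : Ord, (forall x : a, ord_below (segment x) b) ->
    exists f : a -> b, forall x, ord_iso (segment x) (segment (f x))).
  { clear; intros a b H.
    assert (U : forall x : a, {y : b | ord_iso (segment x) (segment y)}).
    { intros x; apply constructive_definite_description.
      destruct (H x) as [y Hy]; exists y; split; [exact Hy|].
      intros y' Hy'; apply ord_iso_segment_inj.
      exact (ord_iso_trans (ord_iso_sym Hy) Hy'). }
    exists (fun x => proj1_sig (U x)); intros x; exact (proj2_sig (U x)). }
  destruct (C a b Ha) as [f Hf], (C b a Hb) as [g Hg].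
  assert (mono : forall (a b : Ord) (f : a -> b),
    (forall x, ord_iso (segment x) (segment (f x))) ->
    forall x y, lt x y -> lt (f x) (f y)).
  { clear; intros a b f Hf x y L.
    assert (M : ord_below (segment x) (segment y)).
    { now apply segment_below. }
    apply segment_below; exact (ord_below_iso (Hf x) (Hf y) M). }
  assert (gf : forall x, g (f x) = x).
  { intros x; apply ord_iso_segment_inj, ord_iso_sym.
    exact (ord_iso_trans (Hf x) (Hg (f x))). }
  assert (fg : forall y, f (g y) = y).
  { intros y; apply ord_iso_segment_inj, ord_iso_sym.
    exact (ord_iso_trans (Hg y) (Hf (g y))). }
  exists f, g; split; [exact gf|split; [exact fg|]].
  intros x y; split; intros L.
  - exact (mono _ _ _ Hf _ _ L).
  - apply (mono _ _ _ Hg) in L; now rewrite 2!gf in L.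
Qed.

Section Sup.
Variables (I : Type) (a : I -> Ord).

Definition sup_map (p : {i : I & a i}) : Ord := segment (projT2 p).

Definition sup_class (p q : {i : I & a i}) : Prop :=
  ord_iso (sup_map p) (sup_map q).

(* The image of [sup_map], made small as the quotient of its domain by the
   kernel; elements of the quotient are equivalence classes. *)
Definition sup_carrier : Type :=
  {P : {i : I & a i} -> Prop | exists p, P = sup_class p}.

Definition sup_lt (P Q : sup_carrier) : Prop :=
  exists p q, proj1_sig P p /\ proj1_sig Q q /\ ord_below (sup_map p) (sup_map q).

Definition to_sup (p : {i : I & a i}) : sup_carrier :=
  exist _ (sup_class p) (ex_intro _ p eq_refl).

Lemma to_sup_surj (P : sup_carrier) : exists p, P = to_sup p.
Proof.
  destruct P as [P [p Hp]]; exists p; now apply sig_ext.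
Qed.

Lemma to_sup_eq p q : ord_iso (sup_map p) (sup_map q) -> to_sup p = to_sup q.
Proof.
  intros H; apply sig_ext; simpl; apply functional_extensionality; intros s.
  apply propositional_extensionality; split; intros L.
  - exact (ord_iso_trans (ord_iso_sym H) L).
  - exact (ord_iso_trans H L).
Qed.

Lemma to_sup_lt p q :
  sup_lt (to_sup p) (to_sup q) <-> ord_below (sup_map p) (sup_map q).
Proof.
  split.
  - intros (p' & q' & Hp & Hq & H); simpl in *.
    exact (ord_below_iso (ord_iso_sym Hp) (ord_iso_sym Hq) H).
  - intros H; exists p, q; simpl; split; [apply ord_iso_refl|].
    split; [apply ord_iso_refl | exact H].
Qed.

Lemma segment_sup_map p (y : sup_map p) :
  ord_iso (segment y) (sup_map (existT _ (projT1 p) (proj1_sig y))).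
Proof. apply ord_iso_segment_segment. Qed.

Definition sup : Ord.
Proof.
  refine (@Build_Ord sup_carrier sup_lt _ _ _).
  - intros P Q R.
    destruct (to_sup_surj P) as [p ->], (to_sup_surj Q) as [q ->],
      (to_sup_surj R) as [r ->].
    rewrite 3!to_sup_lt; apply ord_below_trans.
  - assert (E : forall p q, (forall Z, sup_lt Z (to_sup p) -> sup_lt Z (to_sup q)) ->
      forall y : sup_map p, ord_below (segment y) (sup_map q)).
    { intros p q H y.
      pose proof (segment_sup_map y) as S.
      apply (ord_below_iso (ord_iso_sym S) (ord_iso_refl _)), to_sup_lt, H, to_sup_lt.
      exists y; now apply ord_iso_sym. }
    intros P Q H.
    destruct (to_sup_surj P) as [p ->], (to_sup_surj Q) as [q ->].
    apply to_sup_eq, ord_below_ext; apply E; intros Z; apply H.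
  - assert (W : forall i (x : a i) q, ord_iso (segment x) (sup_map q) ->
      Acc sup_lt (to_sup q)).
    { intros i x; induction (lt_wf x) as [x _ IH]; intros q Hq.
      constructor; intros P; destruct (to_sup_surj P) as [p ->].
      rewrite to_sup_lt; intros H.
      destruct (ord_below_iso (ord_iso_refl _) (ord_iso_sym Hq) H) as [y Hy].
      apply (IH (proj1_sig y) (proj2_sig y)), ord_iso_sym.
      exact (ord_iso_trans Hy (ord_iso_segment_segment y)). }
    intros P; destruct (to_sup_surj P) as [[i x] ->].
    exact (W i x (existT _ i x) (ord_iso_refl _)).
Defined.
End Sup.

(** [sup a] is the least upper bound of [a] for the simulation preorder. *)

Definition ord_le (a b : Ord) : Prop :=
  exists f : a -> b,
    (forall x y, lt x y -> lt (f x) (f y)) /\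
    (forall x z, lt z (f x) -> exists2 x', lt x' x & f x' = z).

Lemma simulation_segment (a b : Ord) (f : a -> b) :
  (forall x y, lt x y -> lt (f x) (f y)) ->
  (forall x z, lt z (f x) -> exists2 x', lt x' x & f x' = z) ->
  forall x, ord_iso (segment x) (segment (f x)).
Proof.
  intros mono sim x; induction (lt_wf x) as [x _ IH]; apply ord_below_ext.
  - intros y.
    refine (ord_below_iso _ (ord_iso_refl _)
              (proj1 (segment_below _ _) (mono _ _ (proj2_sig y)))).
    apply (ord_iso_trans (ord_iso_sym (IH _ (proj2_sig y)))), ord_iso_sym.
    exact (ord_iso_segment_segment y).
  - intros z; destruct (sim _ _ (proj2_sig z)) as [y Hy Ey].
    refine (ord_below_iso _ (ord_iso_refl _) (proj1 (segment_below _ _) Hy)).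
    apply (ord_iso_trans (IH _ Hy)), ord_iso_sym.
    rewrite Ey; exact (ord_iso_segment_segment z).
Qed.

Lemma sup_upper_bound (I : Type) (a : I -> Ord) (i : I) : ord_le (a i) (sup a).
Proof.
  exists (fun x => to_sup (existT _ i x)); split.
  - intros x y L; apply to_sup_lt; now apply segment_below.
  - intros x Z; destruct (to_sup_surj Z) as [p ->]; intros L.
    apply to_sup_lt in L; destruct L as [y Hy].
    exists (proj1_sig y); [exact (proj2_sig y)|].
    apply to_sup_eq, ord_iso_sym.
    exact (ord_iso_trans Hy (ord_iso_segment_segment y)).
Qed.

Lemma sup_least (I : Type) (a : I -> Ord) (b : Ord) :
  (forall i, ord_le (a i) b) -> ord_le (sup a) b.
Proof.
  intros H.
  assert (U : forall P : sup a, {y : b | exists2 p, P = to_sup p &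
                                  ord_iso (sup_map p) (segment y)}).
  { intros P; apply constructive_definite_description.
    destruct (to_sup_surj P) as [[i x] ->], (H i) as (f & mono & sim).
    pose proof (simulation_segment mono sim x) as E.
    exists (f x); split; [now exists (existT _ i x)|].
    intros y [q Hq Ey]; apply ord_iso_segment_inj.
    apply (ord_iso_trans (ord_iso_sym E)).
    refine (ord_iso_trans _ Ey).
    assert (K : proj1_sig (to_sup (existT _ i x)) q)
      by (rewrite Hq; apply ord_iso_refl).
    exact K. }
  exists (fun P => proj1_sig (U P)); split.
  - intros P Q L.
    destruct (proj2_sig (U P)) as [p Hp Ep], (proj2_sig (U Q)) as [q Hq Eq].
    rewrite Hp, Hq in L; apply to_sup_lt in L; apply segment_below.
    exact (ord_below_iso Ep Eq L).
  - intros P z L.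
    destruct (proj2_sig (U P)) as [p Hp Ep].
    apply segment_below in L.
    destruct (ord_below_iso (ord_iso_refl _) (ord_iso_sym Ep) L) as [y Hy].
    pose (q := existT (fun i => carrier (a i)) (projT1 p) (proj1_sig y)).
    assert (Hz : ord_iso (segment z) (sup_map q))
      by exact (ord_iso_trans Hy (segment_sup_map y)).
    exists (to_sup q).
    + rewrite Hp; apply to_sup_lt.
      now apply (segment_below (proj1_sig y) (projT2 p)), (proj2_sig y).
    + destruct (proj2_sig (U (to_sup q))) as [r Hr Er].
      apply ord_iso_segment_inj, (ord_iso_trans (ord_iso_sym Er)).
      apply ord_iso_sym, (ord_iso_trans Hz).
      assert (K : proj1_sig (to_sup q) r) by (rewrite Hr; apply ord_iso_refl).
      exact K.
Qed.

(** * Conatural numbers *)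

Definition Ninf_carrier : Type :=
  {u : nat -> bool | forall i, Bool.le (u (S i)) (u i)}.

Definition Ninf_at (u : Ninf_carrier) (i : nat) : bool := proj1_sig u i.

Lemma Ninf_le (u : Ninf_carrier) m n : m <= n -> Ninf_at u n = true -> Ninf_at u m = true.
Proof.
  induction 1 as [|n _ IH]; [trivial|]; intros H; apply IH.
  pose proof (proj2_sig u n) as D; unfold Ninf_at in *; rewrite H in D; exact D.
Qed.

Definition iota (n : nat) : Ninf_carrier.
Proof.
  refine (exist _ (fun i => i <? n) _).
  intros i; destruct (S i <? n) eqn:E; simpl; [|trivial].
  apply Nat.ltb_lt in E; apply Nat.ltb_lt; lia.
Defined.

Definition infty : Ninf_carrier.
Proof. refine (exist _ (fun _ => true) _); intros i; reflexivity. Defined.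

Lemma iota_at n i : Ninf_at (iota n) i = true <-> i < n.
Proof. apply Nat.ltb_lt. Qed.

Lemma iota_inj m n : iota m = iota n -> m = n.
Proof.
  intros H.
  assert (K : forall i, i < m <-> i < n) by (intros i; now rewrite <- 2!iota_at, H).
  pose proof (K m); pose proof (K n); lia.
Qed.

Lemma iota_embedding : embedding iota.
Proof.
  intros u [m Hm] [n Hn]; apply sig_ext; simpl; apply iota_inj; congruence.
Qed.

Definition Ninf_lt (u v : Ninf_carrier) : Prop :=
  exists n : nat, u = iota n /\ Ninf_at v n = true.

Definition Ninf_ord : Ord.
Proof.
  refine (@Build_Ord Ninf_carrier Ninf_lt _ _ _).
  - intros u v w (m & -> & Hm) (n & -> & Hn); exists m; split; [reflexivity|].
    apply iota_at in Hm; apply (Ninf_le (n := n)); [lia | exact Hn].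
  - assert (E : forall u v, (forall z, Ninf_lt z u -> Ninf_lt z v) ->
      forall i, Ninf_at u i = true -> Ninf_at v i = true).
    { intros u v H i Hi.
      destruct (H (iota i)) as (n & En & Hn); [now exists i|].
      now rewrite (iota_inj En). }
    intros u v H; apply sig_ext, functional_extensionality; intros i.
    apply eq_true_iff_eq; split; apply E; intros z; apply H.
  - assert (W : forall n, Acc Ninf_lt (iota n)).
    { intros n; induction n as [n IH] using (well_founded_induction Wf_nat.lt_wf).
      constructor; intros u (m & -> & Hm); apply IH; now apply iota_at. }
    intros u; constructor; intros v (n & -> & _); apply W.
Defined.

Definition Ninf : TOrd.
Proof.
  refine (@Build_TOrd Ninf_ord infty _); intros v (n & H & _).
  assert (K : Ninf_at infty n = true) by reflexivity.
  rewrite H in K; apply iota_at in K; lia.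
Defined.

(** * Brouwer codes *)

Inductive Brouwer : Type :=
| BZ : Brouwer
| BS : Brouwer -> Brouwer
| BL : (nat -> Brouwer) -> Brouwer.

(* Only the trichotomy of the index [omega] is needed to form the
   lexicographic sum, so this takes values in [Ord], and trichotomy of the
   values is left as a property. *)
Fixpoint interp_Sigma (b : Brouwer) : Ord :=
  match b with
  | BZ => zero
  | BS b => ord_sum (interp_Sigma b) one
  | BL f => lex_sum (t := omega) (fun n => interp_Sigma (f n)) omega_trichotomous
  end.

Fixpoint interp_Sigma1 (b : Brouwer) : TOrd :=
  match b with
  | BZ => tone
  | BS b => tord_sum (interp_Sigma1 b) tone
  | BL f => lex_tsum (t := Ninf) (ext_tord iota_embedding (fun n => interp_Sigma1 (f n)))
  end.

Fixpoint interp_sup1 (b : Brouwer) : Ord :=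
  match b with
  | BZ => one
  | BS b => ord_sum (interp_sup1 b) one
  | BL f => sup (ext_ord iota_embedding (fun n => interp_sup1 (f n)))
  end.

(* Main.v *)
Require Import Defs.
From Stdlib Require Import Arith Bool Lia FunctionalExtensionality.

(** Trichotomy is an induction on codes, since it passes to binary sums and to
    lexicographic sums over a trichotomous index.

    For compactness, the induction runs on a stronger property: a type is
    [searchable] when every [p : X -> bool] comes with a point at which [p] is
    true only if it is true everywhere.  This is compactness together with a
    point, and the point is what makes extension along [iota] work.  The fiber
    of [iota] over a conatural has at most one element but need not be
    decidable, so a product over it is either a copy of one factor or a
    singleton, without one being able to tell which
    ([searchable_prop_product]).  A searching point can nevertheless be written
    down from searching points of the factors.  With Escardo's theorem that the
    conaturals are searchable ([searchable_Ninf]) and closure under dependent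
    sums, both limit constructions are searchable; a supremum is a surjective
    image of the corresponding sum.

    The Cantor space itself is not provably compact without further principles,
    so the retraction does not give compactness, but it does give total
    separatedness, which retracts of the Cantor space inherit
    ([retract_cantor_totally_separated]).  The retraction is again built by
    induction on codes.  At a limit, a sequence that starts with exactly [n]
    ones and then a zero represents the conatural [iota n] together with the
    element of the [n]-th member that the rest of the sequence represents, and
    the sequence of ones represents [infty], where the extended family is a
    singleton.  A digit of the code of a pair [(u, g)] can be computed because the position
    [i] needs [g] only when [u] is already seen to be finite by its [i]-th
    digit. *)

Set Implicit Arguments.
Unset Strict Implicit.

(** * Trichotomy *)

Lemma trichotomous_zero : trichotomous zero.
Proof. intros []. Qed.

Lemma trichotomous_one : trichotomous one.
Proof. intros [] []; left; right; reflexivity. Qed.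

Lemma trichotomous_sum (a b : Ord) :
  trichotomous a -> trichotomous b -> trichotomous (ord_sum a b).
Proof.
  intros Ha Hb [x|x] [y|y]; simpl.
  - destruct (Ha x y) as [[H|H]|H];
      [left; left | left; right; f_equal | right]; exact H.
  - left; left; exact I.
  - right; exact I.
  - destruct (Hb x y) as [[H|H]|H];
      [left; left | left; right; f_equal | right]; exact H.
Qed.

Lemma trichotomous_lex_sum (t : Ord) (u : t -> Ord) (tri : trichotomous t) :
  (forall x, trichotomous (u x)) -> trichotomous (lex_sum u tri).
Proof.
  intros H [x a] [y b]; destruct (tri x y) as [[K|K]|K].
  - left; left; left; exact K.
  - destruct K; destruct (H x a b) as [[L|L]|L].
    + left; left; apply lex_lt_fiber; exact L.
    + left; right; f_equal; exact L.
    + right; apply lex_lt_fiber; exact L.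
  - right; left; exact K.
Qed.

Lemma interp_Sigma_trichotomous (b : Brouwer) : trichotomous (interp_Sigma b).
Proof.
  induction b as [|b IH|f IH]; simpl.
  - exact trichotomous_zero.
  - exact (trichotomous_sum IH trichotomous_one).
  - apply trichotomous_lex_sum; exact IH.
Qed.

(** * Searchable types *)

Definition searchable (X : Type) : Type :=
  forall p : X -> bool, {x0 : X | p x0 = true -> forall x, p x = true}.

Lemma searchable_compact (X : Type) : searchable X -> compact X.
Proof.
  intros H p; destruct (H p) as [x0 H0].
  destruct (p x0) eqn:E; [right | left; now exists x0].
  intros [x Hx]; specialize (H0 eq_refl x); congruence.
Qed.

Lemma searchable_unit : searchable unit.
Proof. intros p; exists tt; now intros H []. Qed.

Lemma searchable_sum (X Y : Type) :
  searchable X -> searchable Y -> searchable (X + Y).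
Proof.
  intros HX HY p.
  destruct (HX (fun x => p (inl x))) as [x0 Hx].
  destruct (HY (fun y => p (inr y))) as [y0 Hy].
  destruct (p (inl x0)) eqn:E.
  - exists (inr y0); intros K [x|y]; auto.
  - exists (inl x0); congruence.
Qed.

Lemma searchable_sigma (X : Type) (Y : X -> Type) :
  searchable X -> (forall x, searchable (Y x)) -> searchable {x : X & Y x}.
Proof.
  intros HX HY p.
  pose (y0 := fun x => proj1_sig (HY x (fun y => p (existT _ x y)))).
  destruct (HX (fun x => p (existT _ x (y0 x)))) as [x0 H0].
  exists (existT _ x0 (y0 x0)); intros K [x y].
  exact (proj2_sig (HY x (fun y => p (existT _ x y))) (H0 K x) y).
Qed.

Lemma searchable_surjection (X Y : Type) (f : X -> Y) :
  (forall y, exists x, y = f x) -> searchable X -> searchable Y.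
Proof.
  intros surj H p; destruct (H (fun x => p (f x))) as [x0 H0].
  exists (f x0); intros K y; destruct (surj y) as [x ->]; exact (H0 K x).
Qed.

(** If [P] has a point [i] then the product is a copy of [X i], and the point
    chosen below is the one found by searching there; if [P] is empty then the
    product is a singleton.  Hence a counterexample to [p] would refute both
    alternatives, although they cannot be told apart. *)
Lemma searchable_prop_product (P : Type) (X : P -> Type) :
  is_prop P -> (forall i, searchable (X i)) -> searchable (forall i, X i).
Proof.
  intros prop H p.
  pose (spread := fun (i : P) (x : X i) (j : P) => eq_rect i X x j (prop i j)).
  assert (spreadE : forall i (y : forall i, X i), spread i (y i) = y).
  { intros i y; apply functional_extensionality_dep; intros j; unfold spread.
    now destruct (prop i j). }
  pose (x0 := fun i => proj1_sig (H i (fun x => p (spread i x)))).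
  exists x0; intros K y.
  destruct (p y) eqn:E; [reflexivity|].
  assert (empty : P -> False).
  { intros i.
    pose proof (proj2_sig (H i (fun x => p (spread i x)))) as Hi; simpl in Hi.
    fold (x0 i) in Hi; rewrite spreadE in Hi.
    specialize (Hi K (y i)); rewrite spreadE in Hi; congruence. }
  replace y with x0 in E; [congruence|].
  apply functional_extensionality_dep; intros i; destruct (empty i).
Qed.

(** * Conatural numbers *)

Lemma Ninf_ext (u v : Ninf_carrier) :
  (forall i, Ninf_at u i = true <-> Ninf_at v i = true) -> u = v.
Proof.
  intros H; apply sig_ext, functional_extensionality; intros i.
  apply eq_true_iff_eq, H.
Qed.

Lemma zero_digit_fiber (u : Ninf_carrier) (i : nat) :
  Ninf_at u i = false -> fiber iota u.
Proof.
  induction i as [|i IH]; intros H.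
  - exists 0; apply Ninf_ext; intros j; rewrite iota_at; split; [lia|].
    intros K; pose proof (Ninf_le (Nat.le_0_l j) K); congruence.
  - destruct (Ninf_at u i) eqn:E; [|exact (IH eq_refl)].
    exists (S i); apply Ninf_ext; intros j; rewrite iota_at; split; intros K.
    + apply (Ninf_le (n := i)); [lia | exact E].
    + destruct (Nat.lt_ge_cases j (S i)) as [L|L]; [exact L|].
      pose proof (Ninf_le L K); congruence.
Qed.

Lemma not_finite_infty (u : Ninf_carrier) : (forall n, u <> iota n) -> u = infty.
Proof.
  intros H; apply Ninf_ext; intros i; split; [reflexivity|]; intros _.
  destruct (Ninf_at u i) eqn:E; [reflexivity|].
  destruct (zero_digit_fiber E) as [n Hn]; now destruct (H n).
Qed.

Fixpoint all_upto (a : nat -> bool) (n : nat) : bool :=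
  match n with
  | 0 => a 0
  | S m => all_upto a m && a (S m)
  end.

Lemma all_upto_true (a : nat -> bool) (n : nat) :
  all_upto a n = true <-> forall j, j <= n -> a j = true.
Proof.
  induction n as [|n IH]; simpl.
  - split; [intros H j L; now replace j with 0 by lia | auto].
  - rewrite andb_true_iff, IH; split.
    + intros [H K] j L; destruct (Nat.eq_dec j (S n)) as [->|N]; [exact K|].
      apply H; lia.
    + auto.
Qed.

Definition leading_ones (a : nat -> bool) : Ninf_carrier.
Proof.
  refine (exist _ (all_upto a) _).
  intros i; simpl; destruct (all_upto a i), (a (S i)); simpl; trivial.
Defined.

Lemma leading_ones_at (a : nat -> bool) (i : nat) :
  Ninf_at (leading_ones a) i = true <-> forall j, j <= i -> a j = true.
Proof. apply all_upto_true. Qed.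

(** The searching point is the least [n] with [p (iota n) = false], or [infty]
    if there is none.  If [p] is true there, then no such [n] exists, so the
    point is [infty], and [p] is true at all finite points and at [infty];
    double negation suffices to pass from these to all conaturals. *)
Lemma searchable_Ninf : searchable Ninf_carrier.
Proof.
  intros p; pose (e := leading_ones (fun n => p (iota n))).
  exists e; intros K.
  assert (fin : forall n, p (iota n) = true).
  { intros n; induction n as [n IH] using (well_founded_induction Wf_nat.lt_wf).
    destruct (p (iota n)) eqn:E; [reflexivity|].
    replace e with (iota n) in K; [congruence|].
    apply Ninf_ext; intros i; unfold e; rewrite iota_at, leading_ones_at.
    split.
    - intros L j Hj; apply IH; lia.
    - intros L; destruct (Nat.lt_ge_cases i n) as [M|M]; [exact M|].
      specialize (L n M); congruence. }
  assert (inf : p infty = true).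
  { replace infty with e; [exact K|].
    apply Ninf_ext; intros i; unfold e; rewrite leading_ones_at.
    split; [reflexivity | auto]. }
  intros u; destruct (p u) eqn:E; [reflexivity|].
  rewrite (@not_finite_infty u) in E; [congruence|].
  intros n ->; specialize (fin n); congruence.
Qed.

(** * Compactness of the interpretations *)

Lemma searchable_iota_extension (X : nat -> Type) :
  (forall n, searchable (X n)) ->
  searchable {u : Ninf_carrier & forall p : fiber iota u, X (proj1_sig p)}.
Proof.
  intros H; apply searchable_sigma; [exact searchable_Ninf|]; intros u.
  apply (@searchable_prop_product (fiber iota u) (fun p => X (proj1_sig p)));
    [apply iota_embedding | auto].
Qed.

Lemma interp_Sigma1_searchable (b : Brouwer) : searchable (interp_Sigma1 b).
Proof.
  induction b as [|b IH|f IH].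
  - exact searchable_unit.
  - apply (@searchable_sigma (unit + unit)).
    + exact (searchable_sum searchable_unit searchable_unit).
    + intros [_|_]; [exact IH | exact searchable_unit].
  - exact (searchable_iota_extension IH).
Qed.

Lemma interp_sup1_searchable (b : Brouwer) : searchable (interp_sup1 b).
Proof.
  induction b as [|b IH|f IH].
  - exact searchable_unit.
  - exact (searchable_sum IH searchable_unit).
  - refine (searchable_surjection (@to_sup_surj _ _) _).
    exact (searchable_iota_extension IH).
Qed.

(** * Retracts of the Cantor space *)

Lemma retract_cantor_totally_separated (X : Type) :
  retract_of X (nat -> bool) -> totally_separated X.
Proof.
  intros (r & s & rs) x y H; rewrite <- (rs x), <- (rs y); f_equal.
  apply functional_extensionality; intros n; exact (H (fun z => s z n)).
Qed.

Lemma retract_cantor_unit : retract_of unit (nat -> bool).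
Proof. exists (fun _ => tt), (fun _ _ => true); now intros []. Qed.

Lemma retract_cantor_binary_sigma (X : unit + unit -> Type) :
  (forall i, retract_of (X i) (nat -> bool)) ->
  retract_of {i : unit + unit & X i} (nat -> bool).
Proof.
  intros H.
  pose (side := fun b : bool => if b then inl tt else inr tt : unit + unit).
  exists (fun a => existT X (side (a 0)) (projT1 (H (side (a 0))) (fun n => a (S n)))).
  exists (fun z n => match n with
    | 0 => match projT1 z with inl _ => true | inr _ => false end
    | S m => proj1_sig (projT2 (H (projT1 z))) (projT2 z) m
    end).
  intros [[[]|[]] x]; simpl; f_equal; apply (proj2_sig (projT2 (H _))).
Qed.

Section LimitRetract.
Variables (X : nat -> Type) (dec : forall n, (nat -> bool) -> X n)
  (enc : forall n, X n -> nat -> bool) (decK : forall n x, dec n (enc x) = x).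

Let limit := {u : Ninf_carrier & forall p : fiber iota u, X (proj1_sig p)}.

Definition limit_decode (a : nat -> bool) : limit :=
  existT _ (leading_ones a)
    (fun p => dec (proj1_sig p) (fun k => a (proj1_sig p + S k))).

(** The conatural may be infinite, and then [enc] has no argument to be applied
    to; the fiber needed for digit [i] is extracted from the zero at [i].  The
    zero at position [n] ends the ones, so the data starts at [n + 1]. *)
Definition limit_encode (z : limit) (i : nat) : bool :=
  match bool_dec (Ninf_at (projT1 z) i) true with
  | left _ => true
  | right h =>
    let p := zero_digit_fiber (not_true_is_false _ h) in
    match i - proj1_sig p with
    | 0 => false
    | S k => enc (projT2 z p) k
    end
  end.

Lemma limit_encode_one (z : limit) (i : nat) :
  Ninf_at (projT1 z) i = true -> limit_encode z i = true.
Proof.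
  intros H; unfold limit_encode.
  now destruct (bool_dec (Ninf_at (projT1 z) i) true).
Qed.

Lemma limit_encode_finite (z : limit) (p : fiber iota (projT1 z)) (d : nat) :
  limit_encode z (proj1_sig p + d) =
  match d with 0 => false | S k => enc (projT2 z p) k end.
Proof.
  unfold limit_encode; destruct (bool_dec _ true) as [h|h].
  - exfalso; rewrite <- (proj2_sig p) in h at 1; apply iota_at in h; lia.
  - rewrite (iota_embedding (zero_digit_fiber (not_true_is_false _ h)) p).
    now replace (proj1_sig p + d - proj1_sig p) with d by lia.
Qed.

Lemma leading_ones_limit_encode (z : limit) :
  leading_ones (limit_encode z) = projT1 z.
Proof.
  apply Ninf_ext; intros i; rewrite leading_ones_at; split.
  - intros H; destruct (Ninf_at (projT1 z) i) eqn:E; [reflexivity|].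
    pose (p := zero_digit_fiber E).
    assert (L : proj1_sig p <= i).
    { apply Nat.nlt_ge; intros L; apply iota_at in L.
      rewrite (proj2_sig p) in L; congruence. }
    pose proof (limit_encode_finite p 0) as K.
    rewrite Nat.add_0_r, (H _ L) in K; discriminate K.
  - intros H j L; apply limit_encode_one, (Ninf_le L H).
Qed.

Lemma limit_ext (z w : limit) :
  projT1 z = projT1 w ->
  (forall n p q, projT2 z (exist _ n p) = projT2 w (exist _ n q)) -> z = w.
Proof.
  destruct z as [u g], w as [v h]; simpl; intros <- H; f_equal.
  apply functional_extensionality_dep; intros [n p]; apply H.
Qed.

Lemma limit_encodeK (z : limit) : limit_decode (limit_encode z) = z.
Proof.
  apply limit_ext; [apply leading_ones_limit_encode|].
  intros n p q; simpl; rewrite <- decK; f_equal.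
  apply functional_extensionality; intros k.
  exact (limit_encode_finite (exist _ n q) (S k)).
Qed.
End LimitRetract.

Lemma retract_cantor_iota_extension (X : nat -> Type) :
  (forall n, retract_of (X n) (nat -> bool)) ->
  retract_of {u : Ninf_carrier & forall p : fiber iota u, X (proj1_sig p)}
    (nat -> bool).
Proof.
  intros H.
  exists (limit_decode (fun n => projT1 (H n))).
  exists (limit_encode (fun n => proj1_sig (projT2 (H n)))).
  apply limit_encodeK; intros n; exact (proj2_sig (projT2 (H n))).
Qed.

Lemma interp_Sigma1_retract (b : Brouwer) :
  retract_of (interp_Sigma1 b) (nat -> bool).
Proof.
  induction b as [|b IH|f IH].
  - exact retract_cantor_unit.
  - apply (@retract_cantor_binary_sigma
      (fun i => tord match i with inl _ => interp_Sigma1 b | inr _ => tone end)).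
    intros [_|_]; [exact IH | exact retract_cantor_unit].
  - exact (retract_cantor_iota_extension IH).
Qed.

Theorem theorem6p7 (b : Brouwer) :
  (trichotomous (interp_Sigma b) *
   (compact (interp_Sigma1 b) * totally_separated (interp_Sigma1 b)) *
   retract_of (interp_Sigma1 b) (nat -> bool) *
   compact (interp_sup1 b))%type.
Proof.
  repeat split.
  - apply interp_Sigma_trichotomous.
  - apply searchable_compact, interp_Sigma1_searchable.
  - apply retract_cantor_totally_separated, interp_Sigma1_retract.
  - apply interp_Sigma1_retract.
  - apply searchable_compact, interp_sup1_searchable.
Qed.
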